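(* Let $I\subset\mathbb{R}$ be an open interval, let $\mathfrak{a}\in C^2(I)$ satisfy $\mathfrak{a}'>0$ on $I$, and let $\mathfrak{F}$ be an antiderivative of $\mathfrak{a}$ on $I$. For $u\in\mathbb{R}$, $v\in I$ let $$P(u,v):=\begin{pmatrix} u & v\\ \mathfrak{a}(v) & u\\ u\,\mathfrak{a}(v) & \frac12u^2+\mathfrak{F}(v)\end{pmatrix}\in M^{3\times 2},$$ and define $\mathcal{K}_1^I:=\{P(u,v): v\in I,\ u\in\mathbb{R}\}$. If the function $\mathfrak{a}$ has an isolated inflection point in $I$, then $\mathcal{K}^I_1$ contains Rank-1 connections. Conversely, if $\mathfrak{a}$ is either strictly convex or strictly concave on $I$, then $\mathcal{K}^I_1$ has no Rank-1 connections.
   Context: $M^{3\times 2}$ is the set of real $3\times2$ matrices. A set $\mathcal{K}\subset M^{3\times 2}$ contains Rank-1 connections if there exist $A,B\in\mathcal{K}$ with $\mathrm{Rank}(A-B)=1$. An isolated inflection point of $\mathfrak{a}$ in $I$ is a point $v_0\in I$ for which there is $\delta>0$ with $(v_0-\delta,v_0+\delta)\subset I$ such that $\mathfrak{a}''$ has one strict sign on $(v_0-\delta,v_0)$ and the opposite strict sign on $(v_0,v_0+\delta)$. *)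

(* Defs.v *)
From HB Require Import structures.
From mathcomp Require Import all_boot all_order all_algebra.
From mathcomp Require Import all_classical all_reals all_analysis.

Set Implicit Arguments.
Unset Strict Implicit.
Unset Printing Implicit Defensive.

Import Order.TTheory GRing.Theory Num.Theory.
Import numFieldNormedType.Exports.

Local Open Scope ring_scope.
Local Open Scope classical_set_scope.

(* A function on the open interval I is a total function R -> R of which only
   the values on I matter: as I is open, derivatives at points of I depend only
   on these values. *)

Definition open_interval (R : realType) (I : set R) : Prop :=
  open I /\ is_interval I.

Definition C2_on (R : realType) (I : set R) (f : R -> R) : Prop :=
  [/\ forall x, I x -> derivable f x 1,
      forall x, I x -> derivable f^`() x 1
    & forall x, I x -> {for x, continuous f^`(2)}].

Definition antiderivative_on (R : realType) (I : set R) (F f : R -> R) : Prop :=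
  forall x, I x -> is_derive x 1 F (f x).

Definition strictly_convex_on (R : realType) (I : set R) (f : R -> R) : Prop :=
  forall x y t : R, I x -> I y -> x != y -> 0 < t < 1 ->
    f (t * x + (1 - t) * y) < t * f x + (1 - t) * f y.

Definition strictly_concave_on (R : realType) (I : set R) (f : R -> R) : Prop :=
  forall x y t : R, I x -> I y -> x != y -> 0 < t < 1 ->
    t * f x + (1 - t) * f y < f (t * x + (1 - t) * y).

Definition isolated_inflection_point (R : realType) (I : set R) (f : R -> R)
    (v0 : R) : Prop :=
  I v0 /\
  exists delta : R, [/\ 0 < delta, `]v0 - delta, v0 + delta[ `<=` I &
    ((forall v : R, v0 - delta < v < v0 -> 0 < f^`(2) v) /\
     (forall v : R, v0 < v < v0 + delta -> f^`(2) v < 0)) \/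
    ((forall v : R, v0 - delta < v < v0 -> f^`(2) v < 0) /\
     (forall v : R, v0 < v < v0 + delta -> 0 < f^`(2) v))].

Definition has_rank1_connections (R : realType) (K : set 'M[R]_(3, 2)) : Prop :=
  exists A B, [/\ K A, K B & \rank (A - B) = 1%N].

(* The 3 x 2 matrix given by the list of its rows. *)
Definition P_mx (R : realType) (a F : R -> R) (u v : R) : 'M[R]_(3, 2) :=
  \matrix_(i < 3, j < 2)
    nth 0 (nth [::] [:: [:: u; v];
                        [:: a v; u];
                        [:: u * a v; 2^-1 * u ^+ 2 + F v]] i) j.

Definition K1 (R : realType) (I : set R) (a F : R -> R) : set 'M[R]_(3, 2) :=
  [set A | exists u v, I v /\ A = P_mx a F u v].

(* Main.v *)
(* Put D g = g(P) - g(Q) for two points P, Q of the surface. The first minor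
   of the difference says (D u)^2 = D v * D a, so by monotonicity of a distinct
   points have D v <> 0 and D u <> 0. Writing D(u^2/2) = m D u and
   D(u a) = m D a + n D u with m, n the means of u and a, the minor of rows 1
   and 3 becomes D u * (D F - n D v): a rank-1 connection is exactly a pair of
   distinct points at which the trapezoid rule is exact for the integral of a.
   Strict convexity (concavity) gives the trapezoid error a strict sign. At an
   inflection point the error has opposite signs on the two sides, and sliding
   an interval of fixed length across the point makes it vanish. *)
Require Import Defs.
From HB Require Import structures.
From mathcomp Require Import all_boot all_order all_algebra.
From mathcomp Require Import all_classical all_reals all_analysis.
From mathcomp Require Import ring lra.

Set Implicit Arguments.
Unset Strict Implicit.
Unset Printing Implicit Defensive.

Import Order.TTheory GRing.Theory Num.Theory.
Import numFieldNormedType.Exports.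

Local Open Scope ring_scope.
Local Open Scope classical_set_scope.

(** The chord inequality for one fixed pair of endpoints, cleared of the denominator [y - x]. It is
    what strict convexity and a sign of the second derivative have in common. *)
Definition below_chord (R : realType) (a : R -> R) (x y : R) : Prop :=
  forall z, x < z < y -> a z * (y - x) < a x * (y - z) + a y * (z - x).

Definition trapezoid_error (R : realType) (F a : R -> R) (x y : R) : R :=
  F y - F x - (a x + a y) / 2 * (y - x).

Lemma MVT_closed (R : realType) (f df : R -> R) (x y : R) : x < y ->
  (forall z, x <= z <= y -> is_derive z 1 f (df z)) ->
  exists2 c, x < c < y & f y - f x = df c * (y - x).
Proof.
move=> xy fdf.
have [||c] := @MVT R f df x y xy.
- by move=> z; rewrite in_itv/= => /andP[xz zy]; apply: fdf; rewrite !ltW.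
- apply: derivable_within_continuous => z; rewrite in_itv/= => zxy.
  by have [] := fdf z zxy.
- by rewrite in_itv/=; exists c.
Qed.

(** The mean value theorem turns the slopes over [[x, z]] and [[z, y]] into [a1 c] and [a1 d] with
    [c < d], and a third application compares these. The point [e] is interior, so an endpoint may
    be the inflection point itself. *)
Lemma below_chord_derive2 (R : realType) (a a1 a2 : R -> R) (x y : R) :
  (forall z, x <= z <= y -> is_derive z 1 a (a1 z)) ->
  (forall z, x <= z <= y -> is_derive z 1 a1 (a2 z)) ->
  (forall z, x < z < y -> 0 < a2 z) -> below_chord a x y.
Proof.
move=> da da1 a2_gt0 z /andP[xz zy].
have [|c /andP[xc cz] ac] := @MVT_closed R a a1 x z xz.
  by move=> w /andP[xw wz]; apply: da; lra.
have [|d /andP[zd dy] ad] := @MVT_closed R a a1 z y zy.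
  by move=> w /andP[xw wz]; apply: da; lra.
have cd : c < d by lra.
have [|e /andP[ce ed] a1e] := @MVT_closed R a1 a2 c d cd.
  by move=> w /andP[xw wz]; apply: da1; lra.
have a1cd : 0 < a1 d - a1 c by rewrite a1e mulr_gt0 ?subr_gt0// a2_gt0//; lra.
have: 0 < (a1 d - a1 c) * ((z - x) * (y - z)).
  by rewrite mulr_gt0// mulr_gt0 ?subr_gt0.
rewrite -(subr_gt0 (a z * _)); congr (0 < _).
have -> : a y * (z - x) = (a y - a z) * (z - x) + a z * (z - x) by ring.
have -> : a x * (y - z) = a z * (y - z) - (a z - a x) * (y - z) by ring.
rewrite ac ad; ring.
Qed.

Lemma trapezoid_error_lt0 (R : realType) (F a : R -> R) (x y : R) : x < y ->
  (forall z, x <= z <= y -> is_derive z 1 F (a z)) ->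
  below_chord a x y -> trapezoid_error F a x y < 0.
Proof.
move=> xy dF chord.
pose s := (a y - a x) / (y - x).
(* The subtracted term is a primitive of the chord: [g] has derivative [a] minus chord, and
   [g y - g x] is the trapezoid error. *)
pose g z := F z - (a x * z + s / 2 * (z - x) ^+ 2).
have dg z : x <= z <= y -> is_derive z 1 g (a z - (a x + s * (z - x))).
  move=> zxy; have dFz := dF z zxy.
  apply: is_deriveB.
  apply: is_derive_eq.
  by rewrite /GRing.scale/= mulr1; field.
have [c cxy gc] := MVT_closed xy dg.
have yx : 0 < y - x by rewrite subr_gt0.
have yx0 : y - x != 0 by rewrite gt_eqF.
have : g y - g x < 0.
  rewrite gc pmulr_llt0// subr_lt0 -(ltr_pM2r yx).
  have -> : (a x + s * (c - x)) * (y - x) = a x * (y - c) + a y * (c - x).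
    by rewrite /s; field.
  exact: chord.
by congr (_ < 0); rewrite /g /s /trapezoid_error; field.
Qed.

Lemma trapezoid_error_continuous (R : realType) (F a a1 : R -> R) (h x y : R) :
  0 <= h ->
  (forall z, x <= z <= y + h -> is_derive z 1 F (a z)) ->
  (forall z, x <= z <= y + h -> is_derive z 1 a (a1 z)) ->
  {within `[x, y], continuous (fun s => trapezoid_error F a s (s + h))}.
Proof.
move=> h0 dF da; apply: derivable_within_continuous => z.
rewrite in_itv/= => /andP[xz zy].
have shift (f f1 : R -> R) :
    (forall z, x <= z <= y + h -> is_derive z 1 f (f1 z)) ->
    derivable f z 1 /\ derivable (fun s => f (s + h)) z 1.
  move=> df; split; first by have [] := df z ltac:(lra).
  have dfz : is_derive (z + h) 1 f (f1 (z + h)) by apply: df; lra.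
  have dsh : is_derive z 1 (fun s => s + h) (1 : R) by exact: is_derive_shift.
  by have [] := @is_derive1_comp R f (fun s => s + h) z _ _ dfz dsh.
have [Fz Fzh] := shift _ _ dF.
have [az azh] := shift _ _ da.
have -> : (fun s => trapezoid_error F a s (s + h)) =
    (fun s => F (s + h)) - F - (h / 2) *: (a + (fun s => a (s + h))).
  by apply/funext => s; rewrite /trapezoid_error !fctE /GRing.scale/=; field.
exact: derivableB (derivableB Fzh Fz) (derivableZ (derivableD az azh)).
Qed.

(** With entries of the form [c i * r j], the vanishing of each 2 x 2 minor becomes a [ring]
    identity. *)
Lemma mxrank1_factor (K : fieldType) (m n : nat) (M : 'M[K]_(m, n)) :
  \rank M = 1%N -> exists c r, forall i j, M i j = c i * r j.
Proof.
move=> M1; move: (col_base M) (row_base M) (mulmx_base M).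
rewrite M1 => c r <-; exists (c^~ 0), (r 0) => i j.
by rewrite mxE big_ord1.
Qed.

Lemma mxrank1_outer_product (K : fieldType) (m n : nat) (M : 'M[K]_(m, n)) c r :
  M != 0 -> (forall i j, M i j = c i * r j) -> \rank M = 1%N.
Proof.
move=> M0 Mcr; apply/eqP; rewrite eqn_leq lt0n mxrank_eq0 M0 andbT.
have -> : M = (\col_i c i) *m (\row_j r j).
  by apply/matrixP => i j; rewrite Mcr !mxE big_ord1 !mxE.
exact: mulmx_max_rank.
Qed.

Lemma K1_rank1_connectionP (R : realType) (I : set R) (a F : R -> R) :
  (forall x y, I x -> I y -> x < y -> a x < a y) ->
  has_rank1_connections (K1 I a F) <->
  exists x y, [/\ I x, I y, x < y & trapezoid_error F a x y = 0].
Proof.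
move=> a_incr; split.
- move=> [_ [_ [[u1 [v1 [I1 ->]]] [u2 [v2 [I2 ->]]] rk]]].
  have [c [r cr]] := mxrank1_factor rk.
  have := (cr 0 0, cr 0 1, cr 1 0, cr 1 1, cr 2 0, cr 2 1).
  rewrite !mxE/= => -[[[[[m00 m01] m10] m11] m20] m21].
  have minor12 : (u1 - u2) ^+ 2 = (v1 - v2) * (a v1 - a v2).
    by rewrite expr2 {1}m00 m11 m01 m10; ring.
  have minor13 : (u1 - u2) * (2^-1 * u1 ^+ 2 + F v1 - (2^-1 * u2 ^+ 2 + F v2))
      = (v1 - v2) * (u1 * a v1 - u2 * a v2).
    by rewrite m00 m21 m01 m20; ring.
  have v12 : v1 != v2.
    apply: contra_eq_neq rk => v12.
    have u12 : u1 = u2.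
      by apply/eqP; rewrite -subr_eq0 -sqrf_eq0 minor12 v12 subrr mul0r.
    by rewrite u12 v12 subrr mxrank0.
  have u12 : u1 - u2 != 0.
    rewrite -sqrf_eq0 minor12 mulf_eq0 !subr_eq0 negb_or v12/=.
    by case: (ltgtP v1 v2) v12 => // v12 _;
      [rewrite lt_eqF|rewrite gt_eqF]; rewrite ?a_incr.
  (* Multiplied by [u1 - u2], this is [minor13] after the terms carrying the mean of [u1] and [u2]
     cancel by [minor12]. *)
  have exact : trapezoid_error F a v2 v1 = 0.
    apply: (mulfI u12); rewrite mulr0 /trapezoid_error.
    have := minor12; have := minor13; nra.
  (* Swapping the endpoints only changes the sign of the error. *)
  case: (ltgtP v1 v2) v12 => // v12 _; [exists v1, v2|exists v2, v1]; split=> //.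
  by move: exact; rewrite /trapezoid_error; lra.
- move=> [x [y [Ix Iy xy]]] /subr0_eq exact.
  have axy := a_incr _ _ Ix Iy xy.
  (* Taking the point over [x] with first parameter 0, the first minor dictates [u] up to sign. *)
  pose u := Num.sqrt ((y - x) * (a y - a x)).
  have uu : u ^+ 2 = (y - x) * (a y - a x).
    by rewrite sqr_sqrtr// mulr_ge0// subr_ge0 ltW.
  have u0 : u != 0 by rewrite gt_eqF// sqrtr_gt0 mulr_gt0// subr_gt0.
  exists (P_mx a F u y), (P_mx a F 0 x); split; [by exists u, y|by exists 0, x|].
  apply: (@mxrank1_outer_product _ _ _ _ (nth 0 [:: 1; (a y - a x) / u; a y])
    (nth 0 [:: u; y - x])).
    by apply/eqP => /matrixP/(_ 0 0); rewrite !mxE/= subr0 => /eqP; apply/negP.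
  move=> [[|[|[|//]]] Hi] [[|[|//]] Hj]; rewrite !mxE/=.
  + by rewrite mul1r subr0.
  + by rewrite mul1r.
  + by field.
  + by rewrite subr0; apply: (mulfI u0); rewrite -expr2 uu; field.
  + by ring.
  + by rewrite uu; lra.
Qed.

Lemma strictly_convex_below_chord (R : realType) (I : set R) (a : R -> R) x y :
  strictly_convex_on I a -> I x -> I y -> below_chord a x y.
Proof.
move=> conv Ix Iy z /andP[xz zy].
have yx : 0 < y - x by lra.
have yx0 : y - x != 0 by rewrite gt_eqF.
have xy : x != y by rewrite lt_eqF//; lra.
have t01 : 0 < (y - z) / (y - x) < 1.
  by rewrite ltr_pdivlMr// ltr_pdivrMr// mul0r mul1r; lra.
have := conv x y ((y - z) / (y - x)) Ix Iy xy t01.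
have -> : (y - z) / (y - x) * x + (1 - (y - z) / (y - x)) * y = z.
  by field.
by rewrite -(ltr_pM2r yx); congr (_ < _); field.
Qed.

Theorem proposition4 (R : realType) (I : set R) (a F : R -> R)
    (hI : open_interval I)
    (ha : C2_on I a)
    (ha' : forall v, I v -> 0 < a^`() v)
    (hF : antiderivative_on I F a) :
  ((exists v0, isolated_inflection_point I a v0) ->
     has_rank1_connections (K1 I a F)) /\
  (strictly_convex_on I a \/ strictly_concave_on I a ->
     ~ has_rank1_connections (K1 I a F)).
Proof.
have [da da1 _] := ha.
have {}da v : I v -> is_derive v 1 a (a^`() v).
  by move=> Iv; rewrite derive1E; apply: derivableP; exact: da.
have {}da1 v : I v -> is_derive v 1 a^`() (a^`(2) v).
  by move=> Iv; rewrite /= derive1E; apply: derivableP; exact: da1.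
have Iin x y z : I x -> I y -> x <= z <= y -> I z by move=> ? ?; exact: hI.2.
have a_incr x y : I x -> I y -> x < y -> a x < a y.
  move=> Ix Iy xy.
  have [|c /andP[xc cy] ac] := @MVT_closed R a a^`() x y xy.
    by move=> z /(Iin _ _ _ Ix Iy); exact: da.
  rewrite -subr_gt0 ac mulr_gt0 ?subr_gt0// ha'//.
  by apply: (Iin x y) => //; rewrite !ltW.
have err_lt0 x y : I x -> I y -> x < y -> below_chord a x y ->
    trapezoid_error F a x y < 0.
  move=> Ix Iy xy; apply: trapezoid_error_lt0 => // z /(Iin _ _ _ Ix Iy).
  exact: hF.
have err_gt0 x y : I x -> I y -> x < y -> below_chord (- a) x y ->
    0 < trapezoid_error F a x y.
  (* The error is linear in the pair [(F, a)], so negating both reverses its sign. *)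
  move=> Ix Iy xy /(@trapezoid_error_lt0 R (- F)) => /(_ xy) H.
  have {H} : trapezoid_error (- F) (- a) x y < 0.
    by apply: H => z /(Iin _ _ _ Ix Iy)/hF dFz; exact: is_deriveN.
  by rewrite /trapezoid_error !fctE; lra.
split; last first.
  move=> cvx /(K1_rank1_connectionP _ a_incr)[x [y [Ix Iy xy]]]; apply/eqP.
  case: cvx => cvx.
    by rewrite lt_eqF// err_lt0//; exact: strictly_convex_below_chord cvx Ix Iy.
  rewrite gt_eqF// err_gt0//; apply: (@strictly_convex_below_chord _ I) => //.
  move=> p q t Ip Iq pq t01; have := cvx p q t Ip Iq pq t01.
  by rewrite !fctE; lra.
move=> [v0 [Iv0 [d [d0 dI sgn]]]].
apply/(K1_rank1_connectionP _ a_incr).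
(* Halving [d] keeps the closed interval [[v0 - h, v0 + h]] inside [I], so derivatives exist at its
   ends too. *)
pose h := d / 2.
have h0 : 0 < h by rewrite divr_gt0.
have hd : h < d by rewrite /h; lra.
have Inear z : v0 - h <= z <= v0 + h -> I z.
  by move=> zh; apply: dI; rewrite /= in_itv/=; lra.
have dF_near z : v0 - h <= z <= v0 + h -> is_derive z 1 F (a z).
  by move=> /Inear; exact: hF.
have da_near z : v0 - h <= z <= v0 + h -> is_derive z 1 a (a^`() z).
  by move=> /Inear; exact: da.
have pos x y : v0 - h <= x -> y <= v0 + h -> x < y ->
    (forall z, x < z < y -> 0 < a^`(2) z) -> trapezoid_error F a x y < 0.
  move=> hx hy xy a2; apply: err_lt0; rewrite //; try (apply: Inear; lra).
  apply: (@below_chord_derive2 _ _ a^`() a^`(2)) => [z zxy|z zxy|z].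
  - by apply: da; apply: Inear; lra.
  - by apply: da1; apply: Inear; lra.
  - exact: a2.
have neg x y : v0 - h <= x -> y <= v0 + h -> x < y ->
    (forall z, x < z < y -> a^`(2) z < 0) -> 0 < trapezoid_error F a x y.
  move=> hx hy xy a2; apply: err_gt0; rewrite //; try (apply: Inear; lra).
  apply: (@below_chord_derive2 _ _ (- derive1 a) (- derive1n 2 a)) =>
      [z zxy|z zxy|z zxy].
  - by apply: is_deriveN; apply: da; apply: Inear; lra.
  - by apply: is_deriveN; apply: da1; apply: Inear; lra.
  - by rewrite oppr_gt0 a2.
(* The window is [[v0 - h, v0]] at [s = v0 - h] and [[v0, v0 + h]] at [s = v0]: at either extreme it
   lies on one side of [v0], where the second derivative has a fixed sign. *)
pose E s := trapezoid_error F a s (s + h).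
have [||s sv Es] := @IVT R E (v0 - h) v0 0 ltac:(lra).
- by apply: (@trapezoid_error_continuous _ _ _ a^`()) => //; exact: ltW.
- rewrite /E subrK.
  case: sgn => -[left right].
    have l : trapezoid_error F a (v0 - h) v0 < 0.
      by apply: pos => [| | |z zh]; [lra|lra|lra|apply: left; lra].
    have r : 0 < trapezoid_error F a v0 (v0 + h).
      by apply: neg => [| | |z zh]; [lra|lra|lra|apply: right; lra].
    by rewrite ge_min le_max (ltW l) (ltW r) orbT.
  have l : 0 < trapezoid_error F a (v0 - h) v0.
    by apply: neg => [| | |z zh]; [lra|lra|lra|apply: left; lra].
  have r : trapezoid_error F a v0 (v0 + h) < 0.
    by apply: pos => [| | |z zh]; [lra|lra|lra|apply: right; lra].
  by rewrite ge_min le_max (ltW l) (ltW r) orbT.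
- move: sv; rewrite in_itv/= => sv.
  by exists s, (s + h); split; [apply: Inear; lra|apply: Inear; lra|lra|exact: Es].
Qed.
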